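(* Let $L$ be a dcpo. Then the following conditions are equivalent: (1) $L$ is strongly continuous; (2) $L$ is continuous, $\ll_s\,=\,\ll$ (as relations on $L$), and $\Uparrow_s x\in\sigma_s(L)$ for all $x\in L$; (3) $L$ is continuous and $\sigma_s(L)=\sigma(L)$.
   Context: A dcpo is a poset in which every directed subset (directed sets are nonempty) has a supremum. For $x\in L$ and $A\subseteq L$: $\uparrow x=\{y\in L: x\le y\}$, $\uparrow A=\bigcup_{a\in A}\uparrow a$; an upper set is a set $U$ with $U=\uparrow U$. Way-below: $x\ll y$ iff for every directed $D\subseteq L$ whose supremum exists, $y\le\sup D$ implies $x\le d$ for some $d\in D$. $L$ is continuous if for every $x\in L$ the set $\{u\in L:u\ll x\}$ is directed with supremum $x$. The Scott topology $\sigma(L)$ consists of the upper sets $U$ such that for every directed $D$ whose supremum exists, $\sup D\in U$ implies $D\cap U\ne\emptyset$. Strong Scott topology: a subset $U\subseteq L$ is strongly Scott open if $U$ is an upper set and for every directed $D\subseteq L$ and every $x\in L$, $\bigcap_{d\in D}\uparrow d\cap\uparrow x\subseteq U$ implies $\uparrow d\cap\uparrow x\subseteq U$ for some $d\in D$. Let $\sigma^s(L)$ be the set of all strongly Scott open subsets. It is closed under binary intersections, and the strong Scott topology $\sigma_s(L)$ is the topology having $\sigma^s(L)$ as a base. A dcpo $L$ is strongly continuous (a strongly continuous domain) if for every $U\in\sigma_s(L)$ and $x\in U$ there is $u\in U$ with $x\in\mathrm{int}_{\sigma_s(L)}\uparrow u\subseteq\uparrow u\subseteq U$ (i.e. $(L,\sigma_s(L))$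 is a C-space). Strong way-below relation: $x\ll_s y$ iff for every directed $D\subseteq L$ and every $a\in L$, $\bigcap_{d\in D}\uparrow d\cap\uparrow a\subseteq\uparrow y$ implies $\uparrow d\cap\uparrow a\subseteq\uparrow x$ for some $d\in D$. Write $\Uparrow_s x=\{y\in L: x\ll_s y\}$. *)

(* Defs.v *)
From HB Require Import structures.
From mathcomp Require Import all_boot all_order.
From mathcomp Require Import boolp classical_sets topology.

Set Implicit Arguments.
Unset Strict Implicit.
Unset Printing Implicit Defensive.

Import Order.TTheory.

Local Open Scope classical_set_scope.
Local Open Scope order_scope.

Section DomainTheory.
Context {d : Order.disp_t} {L : porderType d}.
Implicit Types (x y : L) (A D U : set L).

Definition directed D : Prop :=
  D !=set0 /\ (forall x y, D x -> D y -> exists z, [/\ D z, x <= z & y <= z]).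

Definition upset x : set L := [set y | x <= y].

Definition upclosure A : set L := \bigcup_(a in A) upset a.

Definition upper_set U : Prop := U = upclosure U.

Definition way_below x y : Prop :=
  forall D s, directed D -> isLub D s -> y <= s -> exists2 z, D z & x <= z.

Definition scott_open U : Prop :=
  upper_set U /\
  (forall D s, directed D -> isLub D s -> U s -> D `&` U !=set0).

Definition strongly_scott_open U : Prop :=
  upper_set U /\
  (forall D x, directed D ->
    (\bigcap_(z in D) upset z) `&` upset x `<=` U ->
    exists2 z, D z & upset z `&` upset x `<=` U).

Definition strong_way_below x y : Prop :=
  forall D a, directed D ->
    (\bigcap_(z in D) upset z) `&` upset a `<=` upset y ->
    exists2 z, D z & upset z `&` upset a `<=` upset x.

Lemma upper_setP U :
  upper_set U <-> forall x y, U x -> x <= y -> U y.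
Proof.
split=> [UE x y Ux xy|UP]; first by rewrite UE; exists x.
by apply/seteqP; split=> [x Ux|y [x Ux]]; [exists x => //; exact: lexx|exact: UP].
Qed.

Lemma scott_openT : scott_open setT.
Proof.
split; first exact/upper_setP.
by move=> D s [[x Dx] _] _ _; exists x.
Qed.

Lemma scott_openI : setI_closed scott_open.
Proof.
move=> U V [/upper_setP Uu UP] [/upper_setP Vu VP]; split.
  apply/upper_setP => x y [Ux Vx] xy.
  by split; [exact: Uu xy|exact: Vu xy].
move=> D s dD Ds [Us Vs].
have [x [Dx Ux]] := UP D s dD Ds Us.
have [y [Dy Vy]] := VP D s dD Ds Vs.
have [z [Dz xz yz]] := dD.2 x y Dx Dy.
by exists z; split=> //; split; [exact: Uu xz|exact: Vu yz].
Qed.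

Lemma scott_open_bigU (I : Type) (f : I -> set L) :
  (forall i, scott_open (f i)) -> scott_open (\bigcup_i f i).
Proof.
move=> fP; split.
  apply/upper_setP => x y [i _ fix_] xy; exists i => //.
  by have [/upper_setP fu _] := fP i; exact: fu xy.
move=> D s dD Ds [i _ fis].
by have [x [Dx fix_]] := (fP i).2 D s dD Ds fis; exists x; split=> //; exists i.
Qed.

Lemma strongly_scott_openT : strongly_scott_open setT.
Proof.
split; first exact/upper_setP.
by move=> D x [[y Dy] _] _; exists y.
Qed.

Lemma strongly_scott_openI : setI_closed strongly_scott_open.
Proof.
move=> U V [/upper_setP Uu UP] [/upper_setP Vu VP]; split.
  apply/upper_setP => x y [Ux Vx] xy.
  by split; [exact: Uu xy|exact: Vu xy].
move=> D a dD DUV.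
have [x Dx xU] := UP D a dD (fun t h => (DUV t h).1).
have [y Dy yV] := VP D a dD (fun t h => (DUV t h).2).
have [z [Dz xz yz]] := dD.2 x y Dx Dy.
exists z => // t [zt at_]; split.
  by apply: xU; split=> //; exact: le_trans zt.
by apply: yV; split=> //; exact: le_trans zt.
Qed.

Lemma strongly_scott_open_cover :
  \bigcup_(U in strongly_scott_open) U = setT.
Proof.
by apply/seteqP; split=> // x _; exists setT => //; exact: strongly_scott_openT.
Qed.

Lemma strongly_scott_open_join (U V : set L) x :
  strongly_scott_open U -> strongly_scott_open V -> U x -> V x ->
  exists W, [/\ strongly_scott_open W, W x & W `<=` U `&` V].
Proof.
move=> oU oV Ux Vx; exists (U `&` V); split=> //.
exact: strongly_scott_openI.
Qed.

End DomainTheory.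

(* Aliases of L, each carrying its own topologicalType instance; for the
   second one, strongly_scott_open is only a base of the open sets. *)
Definition scott d (L : porderType d) : Type := L.
Definition strong_scott d (L : porderType d) : Type := L.

HB.instance Definition _ d (L : porderType d) := Choice.on (scott L).
HB.instance Definition _ d (L : porderType d) :=
  isOpenTopological.Build (scott L)
    (@scott_openT d L) (@scott_openI d L) (@scott_open_bigU d L).

HB.instance Definition _ d (L : porderType d) := Choice.on (strong_scott L).
HB.instance Definition _ d (L : porderType d) :=
  isBaseTopological.Build (strong_scott L)
    (@strongly_scott_open_cover d L) (@strongly_scott_open_join d L).

Definition scott_topology d (L : porderType d) : set (set L) :=
  @open (scott L).
Arguments scott_topology {d} L _.

Definition strong_scott_topology d (L : porderType d) : set (set L) :=
  @open (strong_scott L).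
Arguments strong_scott_topology {d} L _.

Lemma scott_topologyE d (L : porderType d) :
  scott_topology L = @scott_open d L.
Proof. by []. Qed.

Lemma strong_scott_topologyE d (L : porderType d) :
  strong_scott_topology L =
  [set \bigcup_(V in B) V | B in [set B | B `<=` @strongly_scott_open d L]].
Proof. by []. Qed.

Definition dcpo d (L : porderType d) : Prop :=
  forall D : set L, directed D -> exists s, isLub D s.

Definition continuous_poset d (L : porderType d) : Prop :=
  forall x : L,
    directed [set u | way_below u x] /\ isLub [set u | way_below u x] x.

(* The C-space property of L equipped with the strong Scott topology. *)
Definition strongly_continuous d (L : porderType d) : Prop :=
  forall (U : set L) (x : L), strong_scott_topology L U -> U x ->
    exists u : L, [/\ U u,
      interior (upset u : set (strong_scott L)) x,
      interior (upset u : set (strong_scott L)) `<=` upset u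
      & upset u `<=` U].

(* Main.v *)
Require Import Defs.
From mathcomp Require Import all_boot all_order.
From mathcomp Require Import boolp classical_sets topology.

(** The strong notions are always at least as strong as the classical ones:
    applying their defining condition to a directed set [D] and a point [a] of
    [D] itself turns the extra cone [upset a] into a mere shift inside [D], so
    [sigma_s] is contained in [sigma] and [<<_s] in [<<]
    ([strong_scott_open_scott], [strong_way_below_way_below]).  The theorem is
    about when these inclusions can be reversed, and the bridge is the relation
    [x \in int_s (upset u)], which entails [u <<_s x]
    ([interior_upset_strong_way_below]).

    If [L] is strongly continuous, the points [u] with [x \in int_s (upset u)]
    form a directed set because a C-space approximates [x] inside any
    intersection of neighbourhoods; its supremum is [x] because complements of
    principal ideals are strongly Scott open
    ([strongly_scott_open_nle]), so that [x] can be approximated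
    from outside the ideal of any point not above it.  Anything way below [x]
    is then below such a [u].  Hence the three relations [<<], [<<_s] and
    [x \in int_s (upset u)] coincide
    ([strongly_continuous_way_belowE],
    [strongly_continuous_strong_way_belowE]), which gives continuity and the
    openness of the sets of points strongly way above a given point.

    In a continuous poset every Scott open set [U] contains, below each of its
    points [x], some [u] way below [x] ([scott_open_way_below]).  So the sets
    of points way above a given point generate [sigma], and [sigma] is
    contained in [sigma_s] as soon as these sets belong to [sigma_s].
    Conversely, these sets are Scott open by interpolation
    ([scott_open_way_above]), so if the two topologies agree they are
    neighbourhoods witnessing the C-space property. *)

Set Implicit Arguments.
Unset Strict Implicit.
Unset Printing Implicit Defensive.

Import Order.TTheory.

Local Open Scope order_scope.
Local Open Scope classical_set_scope.

(** * Strong versus classical notions *)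

Section General.
Context {d : Order.disp_t} {L : porderType d}.
Implicit Types (x y u s : L) (D U : set L).

Lemma bigcap_upset_lub D s :
  isLub D s -> \bigcap_(z in D) upset z = upset s.
Proof.
move=> [sub_s s_le]; apply/seteqP; split=> [y Dy|y sy z Dz].
  by apply: s_le => z Dz; exact: Dy.
exact: le_trans (sub_s _ Dz) sy.
Qed.

(** A cone with apex [a] in [D] is absorbed by [D], since [D] has a point above
    both [a] and any given element of [D]. *)
Lemma directed_cap_upset D a z U :
  directed D -> D a -> D z -> upset z `&` upset a `<=` U ->
  exists2 w, D w & U w.
Proof.
move=> [_ dD] Da Dz zaU; have [w [Dw zw aw]] := dD z a Dz Da.
by exists w => //; apply: zaU.
Qed.

Lemma strongly_scott_open_scott U : strongly_scott_open U -> scott_open U.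
Proof.
move=> [Uu UP]; split=> // D s dD Ds Us; have [[a Da] _] := dD.
have [|z Dz zaU] := UP D a dD.
  rewrite (bigcap_upset_lub Ds) => t [st _].
  by move/upper_setP: Uu; apply; [exact: Us|exact: st].
by have [w Dw Uw] := directed_cap_upset dD Da Dz zaU; exists w.
Qed.

Lemma strong_scott_open_scott U :
  strong_scott_topology L U -> scott_topology L U.
Proof.
rewrite strong_scott_topologyE => -[B sB <-]; rewrite bigcup_set_type.
apply: scott_open_bigU => -[V BV]; apply: strongly_scott_open_scott.
by apply: sB; exact: set_mem.
Qed.

Lemma strong_way_below_way_below x y : strong_way_below x y -> way_below x y.
Proof.
move=> xy D s dD Ds ys; have [[a Da] _] := dD.
have [|z Dz zax] := xy D a dD.
  by rewrite (bigcap_upset_lub Ds) => t [st _]; exact: le_trans st.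
exact: directed_cap_upset zax.
Qed.

Lemma way_below_le x y : way_below x y -> x <= y.
Proof.
move=> xy; have [|||_ -> //] := xy [set y] y; last exact: lexx.
- by split; [exists y|move=> _ _ -> ->; exists y].
- by split=> [_ -> //|z]; apply.
Qed.

Lemma way_below_trans_le x y x' y' :
  x' <= x -> way_below x y -> y <= y' -> way_below x' y'.
Proof.
move=> x'x xy yy' D s dD Ds y's.
have [z Dz xz] := xy D s dD Ds (le_trans yy' y's).
by exists z => //; exact: le_trans xz.
Qed.

(** A basic open set [V] with [x] in [V] and [V] inside [upset u] interpolates:
    a family of cones that shrinks into [upset x] shrinks into [V], so by
    openness one of its members already lies in [V]. *)
Lemma interior_upset_strong_way_below u x :
  interior (upset u : set (strong_scott L)) x -> strong_way_below u x.
Proof.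
rewrite /interior /= nbhsE => -[W [oW Wx] Wu].
move: oW Wx Wu; rewrite -[open W]/(strong_scott_topology L W).
rewrite strong_scott_topologyE => -[B sB <-] [V BV Vx] Wu D a dD Dax.
have [/upper_setP Vup VP] := sB V BV.
have [|z Dz zaV] := VP D a dD; first by move=> t /Dax; exact: Vup.
by exists z => // t /zaV Vt; apply: Wu; exists V.
Qed.

End General.

(** * Strongly continuous domains *)

Section StronglyContinuous.
Context {d : Order.disp_t} {L : porderType d}.
Hypothesis hL : dcpo L.
Implicit Types (x y u b : L).

(** If no upper bound of [D] above [a] lies below [b], then either [a] is
    not below [b], or [sup D], and hence some element of [D], is not; in both
    cases one cone suffices. *)
Lemma strongly_scott_open_nle b : strongly_scott_open [set y | ~ y <= b].
Proof.
split.
  by apply/upper_setP => x y xb xy yb; apply: xb; exact: le_trans yb.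
move=> D a dD Dab; have [s Ds] := hL dD; have [[z0 Dz0] _] := dD.
have [ab|nab] := pselect (a <= b); last first.
  by exists z0 => // t [_ at_] tb; apply: nab; exact: le_trans tb.
have [Db|] := pselect (forall z, D z -> z <= b).
  exfalso; apply: (Dab b) (lexx b); split=> // z Dz; exact: Db.
move=> /existsNP [z /not_implyP [Dz nzb]].
by exists z => // t [zt _] tb; apply: nzb; exact: le_trans tb.
Qed.

Hypothesis scL : strongly_continuous L.

Let below x : set L :=
  [set u | interior (upset u : set (strong_scott L)) x].

Let directed_below x : directed (below x).
Proof.
split.
  by have [u [_ ux _ _]] := scL (U := setT) openT (I : setT x); exists u.
move=> u v ux vx.
have oI : strong_scott_topology L
    (interior (upset u : set (strong_scott L)) `&`
     interior (upset v : set (strong_scott L))).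
  by apply: openI; exact: open_interior.
have [w [[uw vw] wx _ _]] := scL oI (conj ux vx).
by exists w; split=> //; [exact: interior_subset uw|exact: interior_subset vw].
Qed.

Let isLub_below x : isLub (below x) x.
Proof.
split=> [u ux|b bub]; first exact: interior_subset ux.
apply: contrapT => nxb.
have ob : strong_scott_topology L [set y | ~ y <= b].
  rewrite strong_scott_topologyE; exists [set [set y | ~ y <= b]].
    by move=> _ ->; exact: strongly_scott_open_nle.
  exact: bigcup_set1.
by have [u [nub ux _ _]] := scL ob nxb; apply: nub; exact: bub.
Qed.

Lemma strongly_continuous_way_belowE u x :
  way_below u x <-> interior (upset u : set (strong_scott L)) x.
Proof.
split=> [ux|/interior_upset_strong_way_below/strong_way_below_way_below //].
have [v vx uv] := ux _ _ (directed_below x) (isLub_below x) (lexx x).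
by apply: interiorS vx => t; exact: le_trans.
Qed.

Lemma strongly_continuous_continuous : continuous_poset L.
Proof.
move=> x; have -> : [set u | way_below u x] = below x.
  by apply/seteqP; split=> u /strongly_continuous_way_belowE.
by split; [exact: directed_below|exact: isLub_below].
Qed.

Lemma strongly_continuous_strong_way_belowE u x :
  strong_way_below u x <-> interior (upset u : set (strong_scott L)) x.
Proof.
split; last exact: interior_upset_strong_way_below.
by move=> /strong_way_below_way_below/strongly_continuous_way_belowE.
Qed.

End StronglyContinuous.

(** * The Scott topology of a continuous poset *)

Section Continuous.
Context {d : Order.disp_t} {L : porderType d}.
Hypothesis cL : continuous_poset L.
Implicit Types (x u : L) (U : set L).

Lemma scott_open_way_below U x :
  scott_open U -> U x -> exists2 u, U u & way_below u x.
Proof.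
move=> [_ UP] Ux; have [dx lx] := cL x.
by have [u [ux Uu]] := UP _ _ dx lx Ux; exists u.
Qed.

(** Given [u << sup D], the points way below some element of [D] form a
    directed set [E] with the same supremum as [D]; so [u] is below a point
    of [E], that is, way below an element of [D]. *)
Lemma scott_open_way_above u : scott_open [set x | way_below u x].
Proof.
split.
  by apply/upper_setP => x y ux xy; exact: way_below_trans_le (lexx u) ux xy.
move=> D s dD [Ds sD] us.
pose E : set L := [set v | exists2 z, D z & way_below v z].
have dE : directed E.
  split.
    have [z Dz] := dD.1; have [[[v vz] _] _] := cL z.
    by exists v, z.
  move=> v1 v2 [z1 Dz1 vz1] [z2 Dz2 vz2].
  have [z [Dz z1z z2z]] := dD.2 _ _ Dz1 Dz2.
  have [[_ dz] _] := cL z.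
  have [||v [vz v1v v2v]] := dz v1 v2.
  - exact: way_below_trans_le (lexx v1) vz1 z1z.
  - exact: way_below_trans_le (lexx v2) vz2 z2z.
  by exists v; split=> //; exists z.
have lE : isLub E s.
  split=> [v [z Dz /way_below_le vz]|b Eb]; first exact: le_trans (Ds _ Dz).
  apply: sD => z Dz; have [_ [_]] := cL z; apply=> v vz.
  by apply: Eb; exists z.
have [v [z Dz vz] uv] := us E s dE lE (lexx s).
by exists z; split=> //; exact: way_below_trans_le uv vz (lexx z).
Qed.

End Continuous.

Theorem theorem3p12 (d : Order.disp_t) (L : porderType d) (hL : dcpo L) :
  [<-> strongly_continuous L;
       [/\ continuous_poset L,
           forall x y : L, strong_way_below x y <-> way_below x y
         & forall x : L,
             strong_scott_topology L [set y : L | strong_way_below x y]%classic];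
       continuous_poset L /\ strong_scott_topology L = scott_topology L].
Proof.
tfae.
- move=> scL; split; first exact: strongly_continuous_continuous.
    move=> x y; split; first exact: strong_way_below_way_below.
    move=> /(strongly_continuous_way_belowE hL scL).
    exact: interior_upset_strong_way_below.
  move=> x; have -> : [set y | strong_way_below x y] =
      interior (upset x : set (strong_scott L)).
    by apply/seteqP; split=> y
      /(strongly_continuous_strong_way_belowE hL scL).
  exact: open_interior.
- move=> [cL swE oL]; split=> //; apply/seteqP; split=> U.
    exact: strong_scott_open_scott.
  move=> oU.
  have -> : U = \bigcup_(u in U) [set y | strong_way_below u y].
    apply/seteqP; split=> [x Ux|x [u Uu /swE/way_below_le ux]].
      by have [u Uu /swE ux] := scott_open_way_below cL oU Ux; exists u.
    by have [/upper_setP Uup _] := oU; exact: Uup ux.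
  by apply: (@bigcup_open (strong_scott L)) => u _; exact: oL.
- move=> [cL oE] U x oU Ux.
  have sU : scott_open U by exact: strong_scott_open_scott.
  have [u Uu ux] := scott_open_way_below cL sU Ux.
  exists u; split=> //; last 2 first.
  + exact: interior_subset.
  + by move=> y; have [/upper_setP Uup _] := sU; exact: Uup.
  have oA : @open (strong_scott L) [set y | way_below u y].
    rewrite -[open _]/(strong_scott_topology L _) oE.
    exact: scott_open_way_above.
  suff : [set y | way_below u y] `<=`
      interior (upset u : set (strong_scott L)) by exact.
  by rewrite -(open_subsetE _ oA) => y; exact: way_below_le.
Qed.
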